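(* There exists an absolute constant $C>0$ such that for all positive integers $k$ and $n$ with $2k \le n \le C k^2$ there exist two disjoint cross-intersecting families $\mathcal{A}, \mathcal{B} \subset \binom{[n]}{k}$ satisfying $$\min\{|\mathcal{A}|, |\mathcal{B}|\} > \frac{1}{2} \binom{n-1}{k-1}.$$
   Context: $[n]=\{1,\dots,n\}$ and $\binom{[n]}{k}$ denotes the family of all $k$-element subsets of $[n]$. Two families $\mathcal{A},\mathcal{B}$ of sets are cross-intersecting if $A \cap B \neq \emptyset$ for every $A \in \mathcal{A}$ and every $B \in \mathcal{B}$. They are disjoint if no set belongs to both families, i.e. $\mathcal{A}\cap\mathcal{B}=\emptyset$. *)

(* Defs.v *)
From mathcomp Require Import all_boot.

Set Implicit Arguments.
Unset Strict Implicit.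
Unset Printing Implicit Defensive.

(* The ground set [n] = {1, ..., n} is modelled by 'I_n = {0, ..., n - 1}. *)
Definition ksubsets (n k : nat) : {set {set 'I_n}} := [set S : {set 'I_n} | #|S| == k].

Definition cross_intersecting (T : finType) (A B : {set {set T}}) : Prop :=
  forall S U : {set T}, S \in A -> U \in B -> S :&: U != set0.

(* Main.v *)
Require Import Defs.
From mathcomp Require Import all_boot all_order all_algebra.
From mathcomp Require Import reals.
From mathcomp Require Import zify.

Set Implicit Arguments.
Unset Strict Implicit.
Unset Printing Implicit Defensive.

Import Order.TTheory GRing.Theory Num.Theory.
Local Open Scope ring_scope.

(** A star, the family of all [k]-sets through a fixed point [x], has
    [N = 'C(n.-1, k.-1)] members, and cutting it in two gives disjoint
    cross-intersecting families of size about [N / 2]; only a tiny gain is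
    missing.  Fix a [(k-1)]-set [D] avoiding [x].  A [k]-set that contains [D]
    but not [x] meets every member of the star that meets [D].  Hence let [B]
    consist of [N./2.+1] members of the star that meet [D], and let [A] be the
    rest of the star together with the [n - k >= 2] sets [y |: D], where [y] is
    neither [x] nor in [D]: both families exceed [N / 2]
    ([split_star_and_extend]).

    The star must have at least [N./2.+1] members meeting [D].  Those missing
    [D] number ['C(n - k, k.-1)], which is at most [N / 3] once
    [2 * (n - 2 * k + 2) <= k.-1 ^ 2] ([bin_few_avoiding]); this is where [n]
    has to be [O(k ^ 2)], and the constant [1 / 2] suffices. *)

(** Keeping only the terms [j = 0] and [j = 1] of Vandermonde's formula gives
    ['C(m, a) + a * 'C(m, a.-1)], and the hypothesis makes the second term at
    least twice the first. *)
Lemma bin_few_avoiding (m a : nat) :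
  (0 < a)%N -> (a <= m)%N -> (2 * (m - a.-1) <= a ^ 2)%N ->
  (3 * 'C(m, a) <= 'C(m + a, a))%N.
Proof.
case: a => // b _ b_lt_m /= le_sq.
have big2 : (2 * 'C(m, b.+1) <= b.+1 * 'C(m, b))%N.
  have mb_gt0 : (0 < m - b)%N by rewrite subn_gt0.
  (* Scaled by [m - b], absorption turns ['C(m, b)] into ['C(m, b.+1)]. *)
  rewrite -(leq_pmul2l mb_gt0) [leqRHS]mulnCA -mul_bin_left.
  by rewrite mulnCA !mulnA -mulnn in le_sq *; apply: leq_mul.
rewrite addnC -(binomial.Vandermonde b.+1 m) !big_ord_recl /= bin0 bin1 mul1n subn0.
rewrite /bump /= addn0 subn1 /=.
by lia.
Qed.

Lemma exists_subset_card (T : finType) (H : {set T}) (h : nat) :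
  (h <= #|H|)%N -> exists2 B : {set T}, B \subset H & #|B| = h.
Proof.
rewrite -bin_gt0 -cards_draws card_gt0 => /set0Pn[B].
by rewrite inE => /andP[sBH /eqP cardB]; exists B.
Qed.

Section Star.

Variables (T : finType) (x : T).

(** The [j.+1]-sets through [x] with their other points in [E]; the
    [k]-sets through [x] are [star_in [set~ x] k.-1]. *)
Definition star_in (E : {set T}) (j : nat) : {set {set T}} :=
  [set x |: S | S in [set S : {set T} | S \subset E & #|S| == j]].

Lemma card_star_in (E : {set T}) (j : nat) :
  x \notin E -> #|star_in E j| = 'C(#|E|, j).
Proof.
move=> xE; rewrite card_in_imset ?cards_draws // => S1 S2.
rewrite !inE => /andP[/subsetP sub1 _] /andP[/subsetP sub2 _] eq12.
have xS1 : x \notin S1 by apply: contra xE => /sub1.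
have xS2 : x \notin S2 by apply: contra xE => /sub2.
by rewrite -(setU1K xS1) eq12 setU1K.
Qed.

Lemma mem_star_in (E S : {set T}) (j : nat) :
  x \notin E ->
  (S \in star_in E j) = [&& x \in S, S :\ x \subset E & #|S| == j.+1].
Proof.
move=> xE; apply/imsetP/and3P => [[U]|[xS subE /eqP cardS]].
  rewrite inE => /andP[subE /eqP cardU] ->.
  have xU : x \notin U by apply: contra xE => /(subsetP subE).
  by rewrite setU11 setU1K // cardsU1 xU cardU.
exists (S :\ x); last by rewrite setD1K.
by rewrite inE subE; have := cardsD1 x S; rewrite xS cardS => -[->] /=.
Qed.

(** Every set [y |: D] contains [D], so it meets all of [B] as soon as the
    members of [B] meet [D]; it is in neither half of the star because it
    avoids [x].  Giving [N./2.+1] sets of the star to [B] leaves at least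
    [N / 2 - 1] of them to [A], and at least two sets [y |: D] make up for it. *)
Lemma split_star_and_extend (D : {set T}) (N := 'C(#|T|.-1, #|D|)) :
  x \notin D -> (#|D|.+3 <= #|T|)%N ->
  (N./2 < N - 'C(#|T|.-1 - #|D|, #|D|))%N ->
  exists A B : {set {set T}},
    [/\ A \subset [set S : {set T} | #|S| == #|D|.+1],
        B \subset [set S : {set T} | #|S| == #|D|.+1],
        [disjoint A & B], cross_intersecting A B
      & (N < 2 * #|A|)%N /\ (N < 2 * #|B|)%N].
Proof.
move=> xD ltDT lt_hit; set j := #|D| in N ltDT lt_hit *.
pose star := star_in [set~ x] j.
pose missing := star_in (~: (x |: D)) j.
have xNx : x \notin [set~ x] by rewrite !inE eqxx.
have xNxD : x \notin ~: (x |: D) by rewrite !inE eqxx.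
have cardC : #|~: (x |: D)| = (#|T|.-1 - j)%N.
  by rewrite cardsCs setCK cardsU1 xD -subn1 subnDA.
have card_star : #|star| = N by rewrite card_star_in // cardsC1.
have card_missing : #|missing| = 'C(#|T|.-1 - j, j) by rewrite card_star_in // cardC.
have sub_missing : missing \subset star.
  apply: imsetS; apply/subsetP => S; rewrite !inE => /andP[subS ->].
  by rewrite andbT (subset_trans subS) // setCS subsetUl.
have [|B sBhit cardB] := @exists_subset_card _ (star :\: missing) N./2.+1.
  by rewrite cardsD (setIidPr sub_missing) card_star card_missing.
have sBstar : B \subset star by apply: subset_trans sBhit (subsetDl _ _).
pose extra := [set y |: D | y in ~: (x |: D)].
have card_extra : #|extra| = (#|T|.-1 - j)%N.
  rewrite card_in_imset // => y z; rewrite !inE !negb_or.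
  move=> /andP[_ yD] /andP[_ zD] eqyz.
  have : y \in z |: D by rewrite -eqyz setU11.
  by rewrite !inE (negPf yD) orbF => /eqP.
have extra_x S : S \in extra -> x \notin S.
  case/imsetP => y; rewrite !inE negb_or => /andP[yx _] ->.
  by rewrite !inE negb_or xD eq_sym yx.
have star_x S : S \in star -> x \in S by rewrite mem_star_in // => /and3P[].
have dis_extra : [disjoint star & extra].
  by apply/pred0P => S /=; apply/andP => -[/star_x xS /extra_x]; rewrite xS.
have star_size S : S \in star -> #|S| == j.+1.
  by rewrite mem_star_in // => /and3P[].
have hit_D S : S \in star :\: missing -> S :&: D != set0.
  rewrite inE => /andP[+ starS]; apply: contraNneq => SD0.
  move: starS; rewrite !mem_star_in // => /and3P[-> _ ->]; rewrite andbT /=.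
  apply/subsetP => y; rewrite !inE => /andP[yx yS]; rewrite negb_or yx /=.
  apply/negP => yD.
  by have := in_set0 y; rewrite -SD0 inE yS yD.
exists ((star :\: B) :|: extra), B; split.
- apply/subsetP => S; rewrite 2!inE => /orP[|].
    by rewrite inE => /andP[_ /star_size].
  by case/imsetP => y; rewrite !inE negb_or => /andP[_ yD] ->; rewrite cardsU1 yD.
- by apply/subsetP => S /(subsetP sBstar) /star_size; rewrite inE.
- apply/pred0P => S /=; apply/andP => -[]; rewrite !inE => /orP[/andP[/negP]//|].
  by move=> /extra_x /negP + /(subsetP sBstar) /star_x.
- move=> S U; rewrite inE => /orP[/setDP[/star_x xS _]|SE] UB.
    have /star_x xU := subsetP sBstar _ UB.
    by apply/set0Pn; exists x; rewrite inE xS.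
  have /set0Pn[y] := hit_D _ (subsetP sBhit _ UB); rewrite inE => /andP[yU yD].
  have [z _ ->] := imsetP SE.
  by apply/set0Pn; exists y; rewrite !inE yD yU orbT.
have dis : [disjoint star :\: B & extra].
  by apply: disjointWl dis_extra; apply: subsetDl.
have -> : #|(star :\: B) :|: extra| = (N - N./2.+1 + (#|T|.-1 - j))%N.
  move: dis; rewrite -leq_card_setU => /eqP ->.
  by rewrite cardsD (setIidPr sBstar) card_star cardB card_extra.
rewrite cardB; move: lt_hit; move: (N) => M; have := odd_double_half M; lia.
Qed.

End Star.

Theorem mainTheorem2 (R : realType) :
  exists2 C : R, 0 < C &
    forall k n : nat, (0 < k)%N -> (0 < n)%N ->
      (2 * k <= n)%N -> n%:R <= C * k%:R ^+ 2 ->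
      exists A B : {set {set 'I_n}},
        [/\ A \subset ksubsets n k, B \subset ksubsets n k,
            [disjoint A & B], cross_intersecting A B
          & 1 / 2 * 'C(n.-1, k.-1)%:R < (minn #|A| #|B|)%:R :> R].
Proof.
exists (1 / 2); first by rewrite divr_gt0.
move=> k [//|n] k_gt0 _ le_2kn; rewrite mulrC mulrA mulr1 ler_pdivlMr //.
rewrite -natrX -natrM ler_nat => le_nk2.
have k_ge4 : (4 <= k)%N by nia.
(* At most a third of the star of [ord0] misses a [k.-1]-set avoiding [ord0]. *)
have few : (3 * 'C(n - k.-1, k.-1) <= 'C(n, k.-1))%N.
  have := @bin_few_avoiding (n - k.-1) k.-1; rewrite subnK; last by lia.
  by apply; [lia | lia | nia].
have missing_gt1 : (1 < 'C(n - k.-1, k.-1))%N.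
  apply: (@leq_trans 'C(k, k.-1)); last by apply: leq_bin2l; lia.
  by case: (k) k_ge4 => // j; rewrite /= binSn; lia.
have [D sD cardD] : exists2 D : {set 'I_n.+1}, D \subset [set~ ord0] & #|D| = k.-1.
  by apply: exists_subset_card; rewrite cardsC1 card_ord; lia.
have D0 : ord0 \notin D.
  by apply/negP => /(subsetP sD); rewrite !inE eqxx.
have [||A [B []]] := @split_star_and_extend _ ord0 D D0.
- by rewrite cardD card_ord; lia.
- rewrite cardD card_ord /=; move: few missing_gt1.
  move: 'C(n - _, _) 'C(n, _) => M N; have := odd_double_half N; lia.
rewrite cardD card_ord (prednK k_gt0) => sA sB disAB crossAB [ltA ltB].
exists A, B; split=> //.
rewrite mul1r mulrC ltr_pdivrMr // -natrM ltr_nat mulnC.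
by rewrite /minn; case: ifP.
Qed.
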